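(* For every integer $k \geq 2$, there exists a constant $c_k > 0$ such that for every positive integer $n$, there exists a graph $G$ with $\mathrm{td}_2(G) \leq k$ that contains $P_n$ as a subgraph but the longest induced path in $G$ is of order at most $c_k \cdot n^{1/(k-1)}$.
   Context: Graphs are finite and simple; the null graph has no vertices; connected graphs have at least one vertex. $P_n$ denotes the path on $n$ vertices; the order of a path is its number of vertices. An induced path in $G$ is a path that is an induced subgraph of $G$. A cut-vertex of a graph $G$ is a vertex $v$ such that $G-v$ has more components than $G$. A block of $G$ is a maximal connected subgraph of $G$ without a cut-vertex (so blocks are maximal 2-connected subgraphs, cut edges with their endpoints, or isolated vertices). ''$G$ is a block'' means that $G$ is connected and has no cut-vertex. 2-treedepth $\mathrm{td}_2(G)$ is defined recursively: $\mathrm{td}_2(G)=0$ if $G$ is the null graph; $\mathrm{td}_2(G)=\min_{v\in V(G)}\mathrm{td}_2(G-v)+1$ if $G$ is a block; $\mathrm{td}_2(G)=\max_i \mathrm{td}_2(B_i)$ if $G$ has blocks $B_1,\dots,B_m$ with $m>1$. *)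

(* Defs.v *)
From mathcomp Require Import all_boot.

Set Implicit Arguments.
Unset Strict Implicit.
Unset Printing Implicit Defensive.

Record sgraph := SGraph {
  vertex :> finType;
  adj : rel vertex;
  adj_sym : symmetric adj;
  adj_irr : irreflexive adj }.

Section InducedSubgraphs.

(* The graph on vertex set A induced by the adjacency relation e is represented
   by the pair (e, A). *)
Variables (T : finType) (e : rel T).
Implicit Types A B : {set T}.

Definition induced A : rel T := [rel x y in A | e x y].

Definition ncomponents A : nat := n_comp (induced A) A.

Definition connected A : bool :=
  (A != set0) && [forall x in A, forall y in A, connect (induced A) x y].

Definition cut_vertex A v : bool :=
  (v \in A) && (ncomponents A < ncomponents (A :\ v)).

Definition is_block A : bool := connected A && [forall v, ~~ cut_vertex A v].

(* Maximal subgraphs that are blocks can be given by their vertex sets, because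
   they are induced subgraphs: see is_block_sub below. *)
Definition blocks A : {set {set T}} :=
  [set B | maxset (fun C => (C \subset A) && is_block C) B].

(* The recursion is on a bound n for the number of vertices; every recursive
   call is on a graph with strictly fewer vertices, so n = #|A| suffices. The
   default value #|A| of the minimum is never attained. See td2_set0,
   td2_set_block and td2_set_blocks for the resulting equations. *)
Fixpoint td2_rec n A : nat :=
  if n isn't n'.+1 then 0 else
  if A == set0 then 0
  else if is_block A then (\big[minn/#|A|]_(v in A) td2_rec n' (A :\ v)).+1
  else \max_(B in blocks A) td2_rec n' B.

Definition td2_set A : nat := td2_rec #|A| A.

End InducedSubgraphs.

Definition td2 (G : sgraph) : nat := td2_set (@adj G) [set: G].

Definition path_adj n : rel 'I_n := fun i j => (i.+1 == j) || (j.+1 == i).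

Lemma path_adj_sym n : symmetric (@path_adj n).
Proof. by move=> i j; rewrite /path_adj orbC. Qed.

Lemma path_adj_irr n : irreflexive (@path_adj n).
Proof. by move=> i; rewrite /path_adj orbb gtn_eqF. Qed.

Definition path_graph n : sgraph := SGraph (@path_adj_sym n) (@path_adj_irr n).

Definition has_subgraph (H G : sgraph) : Prop :=
  exists2 f : H -> G, injective f & forall x y, adj x y -> adj (f x) (f y).

Definition has_induced_subgraph (H G : sgraph) : Prop :=
  exists2 f : H -> G, injective f & forall x y, adj (f x) (f y) = adj x y.

Section Td2Equations.

Variables (T : finType) (e : rel T).
Implicit Types A B : {set T}.

Lemma is_block_n0 A : is_block e A -> A != set0.
Proof. by case/andP => /andP[]. Qed.

Lemma blocks_proper A B : ~~ is_block e A -> B \in blocks e A -> #|B| < #|A|.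
Proof.
move=> nA; rewrite inE => /maxsetp /andP[sBA bB].
apply: proper_card; rewrite properEneq sBA andbT.
by apply: contraNneq nA => <-.
Qed.

Lemma td2_rec_fuel n A : #|A| <= n -> td2_rec e n A = td2_set e A.
Proof.
rewrite /td2_set; have [m] := ubnP #|A|; elim: m A n => // m IH A n ltAm leAn.
have [A0|An0] := eqVneq A set0.
  by rewrite A0 cards0; case: n {leAn} => //= n; rewrite eqxx.
have [p cA]: exists p, #|A| = p.+1.
  by exists #|A|.-1; rewrite prednK // card_gt0.
rewrite cA; case: n leAn => [|n]; rewrite cA // ltnS => lepn.
rewrite /= (negPf An0) cA.
have rec B : #|B| <= p -> td2_rec e n B = td2_rec e p B.
  move=> leBp; have ltBm: #|B| < m.
    by rewrite cA ltnS in ltAm; apply: leq_ltn_trans ltAm.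
  by rewrite (IH _ _ ltBm leBp) (IH _ _ ltBm (leq_trans leBp lepn)).
case: ifP => [_|/negbT nA].
  congr _.+1; apply: eq_bigr => v vA; apply: rec.
  by have := cardsD1 v A; rewrite vA cA add1n => -[->].
by apply: eq_bigr => B /(blocks_proper nA); rewrite cA ltnS; apply: rec.
Qed.

Lemma td2_set0 : td2_set e set0 = 0.
Proof. by rewrite /td2_set cards0. Qed.

Lemma td2_set_blocks A : A != set0 -> ~~ is_block e A ->
  td2_set e A = \max_(B in blocks e A) td2_set e B.
Proof.
move=> An0 nA; rewrite -(td2_rec_fuel (leqnSn _)) /= (negPf An0) (negPf nA).
apply: eq_bigr => B /(blocks_proper nA) /ltnW; exact: td2_rec_fuel.
Qed.

Lemma blocks_gt1 A : A != set0 -> ~~ is_block e A -> 1 < #|blocks e A|.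
Proof.
move=> An0 nA.
have cover x : x \in A -> exists2 B, B \in blocks e A & x \in B.
  move=> xA; have bx: is_block e [set x].
    apply/andP; split; first apply/andP; [split|].
    - by apply/set0Pn; exists x; rewrite inE.
    - by apply/'forall_implyP => y /set1P->; apply/forall_inP=> z /set1P->.
    apply/forallP=> v; rewrite /cut_vertex inE; case: eqP => //= ->.
    rewrite setDv -leqNgt /ncomponents /n_comp_mem.
    by rewrite (_ : #|_| = 0) // eq_card0 // => z; rewrite !inE andbF.
  have Px: ([set x] \subset A) && is_block e [set x] by rewrite sub1set xA.
  have [B mB sxB] := maxset_exists (P := fun C => (C \subset A) && is_block e C) Px.
  by exists B; rewrite ?inE // -sub1set.
rewrite ltnNge; apply/negP => le1.
have /set0Pn[x xA] := An0; have [B bB _] := cover x xA.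
have sAB: A \subset B.
  apply/subsetP=> y /cover[C bC]; suff -> : B = C by [].
  by move/card_le1_eqP: le1; apply.
by have := blocks_proper nA bB; rewrite ltnNge subset_leq_card.
Qed.

Let bigminn_le A (F : T -> nat) d v :
  v \in A -> \big[minn/d]_(u in A) F u <= F v.
Proof.
move=> vA; have := mem_index_enum v.
elim: (index_enum T) => // u s IH; rewrite inE big_cons.
case/predU1P => [<-|/IH le_s]; first by rewrite vA geq_minl.
by case: ifP => // _; apply: leq_trans (geq_minr _ _) le_s.
Qed.

Lemma td2_set_leq A : td2_set e A <= #|A|.
Proof.
have [m] := ubnP #|A|; elim: m A => // m IH A ltAm.
have [->|An0] := eqVneq A set0; first by rewrite td2_set0.
have IH' B : #|B| < #|A| -> td2_set e B <= #|B|.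
  by move=> ltBA; apply: IH; apply: leq_trans ltBA _; rewrite -ltnS.
have [bA|nA] := boolP (is_block e A); last first.
  rewrite td2_set_blocks //; apply/bigmax_leqP => B /(blocks_proper nA) ltBA.
  exact: leq_trans (IH' _ ltBA) (ltnW ltBA).
have [v vA] := set0Pn _ An0.
rewrite -(td2_rec_fuel (leqnSn _)) /= (negPf An0) bA.
have cA := cardsD1 v A; rewrite vA add1n in cA.
rewrite [leqRHS]cA ltnS; apply: leq_trans (bigminn_le _ _ vA) _.
by rewrite td2_rec_fuel ?IH' // cA.
Qed.

Lemma td2_set_block A : is_block e A ->
  (exists2 v, v \in A & td2_set e A = (td2_set e (A :\ v)).+1) /\
  (forall v, v \in A -> td2_set e A <= (td2_set e (A :\ v)).+1).
Proof.
move=> bA; have An0 := is_block_n0 bA; have [v0 v0A] := set0Pn _ An0.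
have cD v : v \in A -> #|A| = #|A :\ v|.+1 by move=> vA; rewrite (cardsD1 v) vA.
have -> : td2_set e A = (\big[minn/#|A|]_(v in A) td2_set e (A :\ v)).+1.
  rewrite -(td2_rec_fuel (leqnSn _)) /= (negPf An0) bA; congr _.+1.
  by apply: eq_bigr => v /cD cA; apply: td2_rec_fuel; rewrite cA.
have min_le v : v \in A ->
    \big[minn/#|A|]_(u in A) td2_set e (A :\ u) <= td2_set e (A :\ v).
  exact: bigminn_le.
split=> [|v /min_le]; last by [].
have: \big[minn/#|A|]_(u in A) td2_set e (A :\ u) = #|A| \/
    exists2 v, v \in A &
      \big[minn/#|A|]_(u in A) td2_set e (A :\ u) = td2_set e (A :\ v).
  apply: (big_ind (fun m => m = #|A| \/
    exists2 v, v \in A & m = td2_set e (A :\ v))); first by left.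
  - by move=> x y Hx Hy; rewrite /minn; case: ifP.
  - by move=> v vA; right; exists v.
case=> [E|[v vA ->]]; last by exists v.
have := min_le v0 v0A; rewrite E (cD v0 v0A) ltnNge.
by rewrite td2_set_leq.
Qed.

End Td2Equations.

Section BlocksAreInduced.

Variables (T : finType) (e e' : rel T).
Hypotheses (e_sym : symmetric e) (e'_sym : symmetric e') (see' : subrel e e').
Implicit Type A : {set T}.

Let ind_sym (r : rel T) A : symmetric r -> connect_sym (induced r A).
Proof.
move=> r_sym; apply: sym_connect_sym => x y.
by rewrite /induced /= r_sym [(x \in A) && _]andbC.
Qed.

Let ind_closed (r : rel T) A x y :
  connect (induced r A) x y -> x \in A -> y \in A.
Proof.
case/connectP=> p; elim: p x => [|z p IH] x /= => [_ -> //|].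
by case/andP=> /andP[/andP[_ zA] _] pz lz _; apply: IH pz lz zA.
Qed.

Let connect_ind A : subrel (connect (induced e A)) (connect (induced e' A)).
Proof.
apply: connect_sub => x y /= /andP[xyA /see' exy].
by apply: connect1; rewrite /induced /= xyA.
Qed.

Lemma ncomponents_sub A : ncomponents e' A <= ncomponents e A.
Proof.
rewrite /ncomponents /n_comp_mem.
have inj: {in predI (roots (induced e' A)) (mem A) &,
    injective (root (induced e A))}.
  move=> x y /andP[/= /eqP rx _] /andP[/= /eqP ry _].
  move/(rootP (ind_sym A e_sym))/connect_ind.
  by move/(rootP (ind_sym A e'_sym)); rewrite rx ry.
rewrite -(card_in_image inj); apply: subset_leq_card.
apply/subsetP=> _ /imageP[x /andP[_ /= xA] ->].
rewrite !inE /= roots_root; last exact: ind_sym.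
exact: ind_closed (connect_root _ x) xA.
Qed.

(* If a (not necessarily induced) subgraph with vertex set A is a block, so is
   the subgraph induced by A. *)
Lemma is_block_sub A : is_block e A -> is_block e' A.
Proof.
case/andP=> /andP[An0 /forall_inP conA] /forallP nocut.
have con x y : x \in A -> y \in A -> connect (induced e A) x y.
  by move=> xA; move/forall_inP: (conA x xA); apply.
apply/andP; split.
  rewrite /connected An0; apply/forall_inP=> x xA; apply/forall_inP=> y yA.
  exact/connect_ind/con.
apply/forallP=> v; have := nocut v; rewrite /cut_vertex.
case: (v \in A) => //=; rewrite -!leqNgt => le_v.
apply: leq_trans (ncomponents_sub _) (leq_trans le_v _).
apply: (@leq_trans 1).
  apply/card_le1_eqP => x y /andP[/= /eqP rx xA] /andP[/= /eqP ry yA].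
  by have /(rootP (ind_sym A e_sym)) := con x y xA yA; rewrite rx ry.
have [x xA] := set0Pn _ An0; apply/card_gt0P.
exists (root (induced e' A) x); rewrite !inE /= roots_root; last exact: ind_sym.
exact: ind_closed (connect_root _ x) xA.
Qed.

End BlocksAreInduced.

(* Main.v *)
(* Starting from a single vertex, iterate [d = k - 1] times the following step:
   take [s] disjoint copies of the current graph [H], add to each of them an
   apex adjacent to all of it, and chain the resulting cones by edges from the
   last vertex of a cone to the apex of the next one. This raises td_2 by at
   most one, since every block is a single edge or lies in a cone, and
   multiplies the order of a Hamiltonian path by at least [s]. An induced path
   has at most 3 vertices in any cone whose apex it contains. As the apex
   separates its cone from the previous ones, all its other vertices lie in one
   cone, the first one it meets, where they form at most two induced paths of
   [H] (separated by the apex of the next cone). So the bound [L] on induced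
   paths becomes [2 * L + 3 * s], which keeps it at most [5 ^ d * s], and
   [s = ceil (n ^ (1 / d))] suffices. *)
Require Import Defs.
From mathcomp Require Import all_boot all_order all_algebra.
From mathcomp Require Import zify.
From mathcomp Require Import reals exp.
Import Order.TTheory GRing.Theory Num.Theory.

Set Implicit Arguments.
Unset Strict Implicit.
Unset Printing Implicit Defensive.

(** * Monotonicity of 2-treedepth and connectivity of blocks *)

Section Td2Bounds.

Variables (T : finType) (e : rel T).
Implicit Types A B C : {set T}.

Lemma td2_set_le_blocks A k :
  (forall C, C \subset A -> is_block e C -> td2_set e C <= k) ->
  td2_set e A <= k.
Proof.
move=> le_k; have [->|An0] := eqVneq A set0; first by rewrite td2_set0.
have [bA|nA] := boolP (is_block e A); first exact: le_k.
rewrite td2_set_blocks //; apply/bigmax_leqP=> C.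
by rewrite inE => /maxsetp/andP[]; apply: le_k.
Qed.

(** If both sets are blocks, a vertex [v] optimal for [A] is deleted from both; otherwise [B] is
    replaced by its blocks, or [A] by a block containing [B]. *)
Lemma td2_set_mono A B : B \subset A -> td2_set e B <= td2_set e A.
Proof.
have [m] := ubnP (#|A| + #|B|); elim: m A B => // m IH A B lt_m sBA.
have [->|Bn0] := eqVneq B set0; first by rewrite td2_set0.
have [bB|nB] := boolP (is_block e B); last first.
  rewrite td2_set_blocks //; apply/bigmax_leqP=> C CB.
  have ltCB := blocks_proper nB CB.
  apply: IH; first by lia.
  by move: CB; rewrite inE => /maxsetp/andP[sCB _]; apply: subset_trans sBA.
have [bA|nA] := boolP (is_block e A); last first.
  have An0 : A != set0 by apply: contraNneq Bn0 => A0; rewrite -subset0 -A0.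
  have PB : (B \subset A) && is_block e B by rewrite sBA.
  have [C mC sBC] := maxset_exists (P := fun C => (C \subset A) && is_block e C) PB.
  have CA : C \in blocks e A by rewrite inE.
  have ltCA := blocks_proper nA CA.
  rewrite [leqRHS]td2_set_blocks //; apply: (@leq_trans (td2_set e C)).
    by apply: IH => //; lia.
  exact: (@leq_bigmax_cond _ (fun C => C \in blocks e A) (td2_set e)).
have [[v vA ->] _] := td2_set_block bA.
have cA := cardsD1 v A; rewrite vA add1n in cA.
have [vB|vB] := boolP (v \in B).
  apply: leq_trans (proj2 (td2_set_block bB) v vB) _; rewrite ltnS.
  have cB := cardsD1 v B; rewrite vB add1n in cB.
  by apply: IH; [lia | apply: setSD].
by apply: leqW; apply: IH; [lia | rewrite subsetD1 sBA].
Qed.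

(** A block in [A] that contains [v] obeys the recursion bound at [v]; any other block lies in
    [A :\ v]. *)
Lemma td2_set_delete A v : td2_set e A <= (td2_set e (A :\ v)).+1.
Proof.
apply: td2_set_le_blocks => C sCA bC.
have [vC|vC] := boolP (v \in C).
  apply: leq_trans (proj2 (td2_set_block bC) v vC) _.
  by rewrite ltnS td2_set_mono // setSD.
by apply: leqW; apply: td2_set_mono; rewrite subsetD1 sCA.
Qed.

Hypothesis e_sym : symmetric e.

Let ind_sym A : connect_sym (induced e A).
Proof.
apply: sym_connect_sym => x y.
by rewrite /induced /= e_sym [(x \in A) && _]andbC.
Qed.

Lemma block_connect_delete C v x y : is_block e C ->
  x \in C :\ v -> y \in C :\ v -> connect (induced e (C :\ v)) x y.
Proof.
case/andP=> /andP[_ /forall_inP conC] /forallP /(_ v) ncut xCv yCv.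
have con z z' : z \in C -> z' \in C -> connect (induced e C) z z'.
  by move=> zC; move/forall_inP: (conC z zC); apply.
have [vC|vC] := boolP (v \in C); last first.
  have E : C :\ v = C by apply/setDidPl; rewrite disjoint_sym disjoints1.
  by rewrite E in xCv yCv *; apply: con.
have root_in z : z \in C :\ v ->
    fingraph.root (induced e (C :\ v)) z \in predI (roots (induced e (C :\ v))) (mem (C :\ v)).
  move=> zC; apply/andP; split; first by rewrite /= roots_root.
  have cl : closed (induced e (C :\ v)) (mem (C :\ v)).
    by move=> a b /andP[/andP[/= -> ->] _].
  by move: zC; rewrite (closed_connect cl (connect_root _ z)).
move: ncut; rewrite /cut_vertex vC /= -leqNgt => le1.
have {}le1 : ncomponents e (C :\ v) <= 1.
  apply: leq_trans le1 _; apply/card_le1_eqP => a b /andP[/= /eqP ra aC] /andP[/= /eqP rb bC].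
  by have /(fingraph.rootP (ind_sym _)) := con a b aC bC; rewrite ra rb.
apply/(fingraph.rootP (ind_sym _)).
by move/card_le1_eqP: le1; apply; apply: root_in.
Qed.

(** A block stays connected after losing the at most one vertex in [S], so a property preserved
    along the remaining edges spreads to all of the rest. *)
Lemma block_separation C (S P : pred T) : is_block e C ->
  {in C &, forall x y, S x -> S y -> x = y} ->
  {in C &, forall x y, ~~ S x -> ~~ S y -> P x -> e x y -> P y} ->
  {in C &, forall x y, ~~ S x -> ~~ S y -> P x -> P y}.
Proof.
move=> bC S1 inv x y xC yC nSx nSy Px.
have key (D : {set T}) : D \subset C -> {in D, forall z, ~~ S z} ->
    connect (induced e D) x y -> P y.
  move=> sDC nSD /connectP[p]; elim: p x Px {xC nSx} => [|z p IH] x Px /=.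
    by move=> _ ->.
  case/andP=> /andP[/andP[xD zD] exz]; apply: IH.
  by apply: inv exz => //; rewrite ?nSD ?(subsetP sDC).
have [v /andP[vC Sv]|noS] := pickP [pred v in C | S v].
  apply: (key (C :\ v)); first exact: subsetDl.
    move=> z /setD1P[zv zC]; apply: contra zv => Sz.
    by apply/eqP; apply: S1.
  apply: block_connect_delete => //; apply/setD1P; split=> //.
    by apply: contraNneq nSx => ->.
  by apply: contraNneq nSy => ->.
apply: (key C) => // [z zC|]; first by have := noS z; rewrite /= zC /= => ->.
case/andP: bC => /andP[_ /forall_inP conC] _.
by have /forall_inP := conC x xC; apply.
Qed.

End Td2Bounds.

(** * Chains of cones and their 2-treedepth *)

(* Segment [q] is the interval [q * h.+1, q.+1 * h.+1): its first vertex is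
   adjacent to the whole segment, the other ones carry a copy of [e], and its
   last vertex is adjacent to the first vertex of segment [q.+1]. *)
Definition cone_chain (h : nat) (e : rel nat) : rel nat := fun i j =>
  if i %/ h.+1 == j %/ h.+1 then
    if i %% h.+1 == 0 then j %% h.+1 != 0
    else (j %% h.+1 == 0) || e (i %% h.+1).-1 (j %% h.+1).-1
  else (i.+1 == j) || (j.+1 == i).

Lemma cone_chain_sym h (e : rel nat) : symmetric e -> symmetric (cone_chain h e).
Proof.
move=> es i j; rewrite /cone_chain eq_sym; case: ifP => _; last by rewrite orbC.
by rewrite es; case: (i %% _ == 0); case: (j %% _ == 0).
Qed.

Lemma cone_chain_irr h (e : rel nat) : irreflexive e -> irreflexive (cone_chain h e).
Proof. by move=> ei i; rewrite /cone_chain eqxx ei; case: (i %% _ == 0). Qed.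

Lemma cone_chain_succ h (e : rel nat) i :
  (forall j, j.+1 < h -> e j j.+1) -> cone_chain h e i i.+1.
Proof.
move=> eS; rewrite /cone_chain; case: eqP => [Eq|_]; last by rewrite eqxx.
have Er : i.+1 %% h.+1 = (i %% h.+1).+1.
  by have := divn_eq i h.+1; have := divn_eq i.+1 h.+1; rewrite -Eq; lia.
rewrite Er /=; case: eqP => // /eqP i0.
have := ltn_pmod i.+1 (ltn0Sn h); rewrite Er ltnS => lt_h.
by have := eS (i %% h.+1).-1; rewrite prednK ?lt0n //; apply.
Qed.

(** An edge inside a segment cannot cross the boundary [t], and all other edges join consecutive
    integers. *)
Lemma cone_chain_jump h (e : rel nat) t i j : h.+1 %| t -> i < t <= j ->
  cone_chain h e i j -> i.+1 = t /\ j = t.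
Proof.
move=> /dvdnP[q Et] /andP[lt_it le_tj]; rewrite /cone_chain ifN; first by lia.
by move: lt_it le_tj; rewrite Et -leq_divRL // -ltn_divLR //; lia.
Qed.

(** The labelling [f] into [nat] lets the bound pass to vertex subsets. A block inside one segment
    falls into a copy of [e] once its apex is deleted; a block meeting two segments has at most two
    vertices, and [0 < k] gives [2 <= k.+1]. *)
Lemma td2_cone_chain (T : finType) (r : rel T) (h k : nat) (e : rel nat)
    (A : {set T}) (f : T -> nat) :
  0 < k -> symmetric r ->
  (forall (B : {set T}) (g : T -> nat), {in B &, injective g} ->
     {in B, forall x, g x < h} -> {in B &, forall x y, r x y = e (g x) (g y)} ->
     td2_set r B <= k) ->
  {in A &, injective f} ->
  {in A &, forall x y, r x y = cone_chain h e (f x) (f y)} ->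
  td2_set r A <= k.+1.
Proof.
move=> k_gt0 r_sym IH f_inj rE; apply: td2_set_le_blocks => C /subsetP sCA bC.
have fC : {in C &, injective f} by move=> x y xC yC; apply: f_inj; apply: sCA.
have rC : {in C &, forall x y, r x y = cone_chain h e (f x) (f y)}.
  by move=> x y xC yC; apply: rE; apply: sCA.
have [/forall_inP same|] :=
  boolP [forall x in C, forall y in C, f x %/ h.+1 == f y %/ h.+1].
  have {}same x y : x \in C -> y \in C -> f x %/ h.+1 = f y %/ h.+1.
    by move=> xC yC; have /forall_inP/(_ y yC)/eqP := same x xC.
  (* Without its apex a segment is a copy of [e], indexed by the offset minus one. *)
  have sub (B : {set T}) : B \subset C -> {in B, forall x, f x %% h.+1 != 0} ->
      td2_set r B <= k.
    move=> /subsetP sBC B0; apply: (IH _ (fun x => (f x %% h.+1).-1)).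
    - move=> x y xB yB E; apply: fC; rewrite ?sBC //.
      rewrite (divn_eq (f x) h.+1) (divn_eq (f y) h.+1).
      rewrite (same x y) ?sBC //; congr (_ + _).
      by have := B0 x xB; have := B0 y yB; lia.
    - move=> x xB; have := B0 x xB; have := ltn_pmod (f x) (ltn0Sn h); lia.
    move=> x y xB yB; rewrite rC ?sBC // /cone_chain (same x y) ?sBC // eqxx.
    by rewrite (negPf (B0 x xB)) (negPf (B0 y yB)).
  have [v /andP[vC /= /eqP v0]|no] := pickP [pred v in C | f v %% h.+1 == 0].
    apply: leq_trans (td2_set_delete r C v) _; rewrite ltnS.
    apply: sub; first exact: subsetDl.
    move=> x /setD1P[xv xC]; apply: contra xv => /eqP x0.
    apply/eqP/fC => //; rewrite (divn_eq (f x) h.+1) (divn_eq (f v) h.+1).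
    by rewrite x0 v0 (same x v).
  apply: leqW; apply: sub => // x xC.
  by have := no x; rewrite /= xC /= => ->.
move=> /forall_inPn[x0 x0C /forall_inPn[y0 y0C neq]].
wlog lt_xy : x0 y0 x0C y0C neq / f x0 %/ h.+1 < f y0 %/ h.+1.
  move=> W; case: (ltngtP (f x0 %/ h.+1) (f y0 %/ h.+1)) => [||E].
  - exact: W.
  - by apply: W => //; rewrite eq_sym.
  by rewrite E eqxx in neq.
(* Only the edge between [t.-1] and [t] joins the two sides of [t]. *)
set t := f y0 %/ h.+1 * h.+1.
have dt : h.+1 %| t by apply: dvdn_mull.
have x0t : f x0 < t by rewrite -ltn_divLR.
have y0t : t <= f y0 by apply: leq_divM.
(* Deleting either end [c] of this edge separates what is left below [t] from what is left above, so
   a block meeting both sides consists of the two ends. *)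
have sep c x y : c = t.-1 \/ c = t -> x \in C -> y \in C ->
    f x != c -> f y != c -> f x < t -> f y < t.
  move=> Ec xC yC.
  apply: (@block_separation _ r r_sym C (fun x => f x == c) (fun x => f x < t)) => //.
    by move=> {xC yC}x {}y xC yC /eqP Ex /eqP Ey; apply: fC; rewrite ?Ex.
  move=> {xC yC}x {}y xC yC nx ny ltx; rewrite rC // => rxy.
  rewrite ltnNge; apply/negP => ley.
  have [] := cone_chain_jump dt _ rxy; rewrite ?ltx //.
  by case: Ec; move: nx ny => /=; lia.
have lo z : z \in C -> t.-1 <= f z.
  move=> zC; rewrite leqNgt; apply/negP => lt_z.
  by have := sep t.-1 z y0 (or_introl erefl) zC y0C; lia.
have hi z : z \in C -> f z <= t.
  move=> zC; rewrite leqNgt; apply/negP => lt_z.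
  by have := sep t x0 z (or_intror erefl) x0C zC; lia.
apply: leq_trans (td2_set_leq r C) _; apply: (@leq_trans 2) => //.
rewrite cardE -(size_map f); apply: (@uniq_leq_size _ _ [:: t.-1; t]).
  by rewrite map_inj_in_uniq ?enum_uniq // => x y; rewrite !mem_enum; apply: fC.
move=> _ /mapP[z zC ->]; rewrite mem_enum in zC.
by have := lo z zC; have := hi z zC; rewrite !inE; lia.
Qed.

(** Only the values of [p] below [m] matter, so subpaths are obtained by shifting indices. *)
Definition induced_path (e : rel nat) (h m : nat) (p : nat -> nat) : Prop :=
  [/\ forall i, i < m -> p i < h,
      forall i j, i < m -> j < m -> p i = p j -> i = j &
      forall i j, i < m -> j < m -> e (p i) (p j) = (i.+1 == j) || (j.+1 == i)].

(** * Induced paths in a chain of cones *)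

Section InducedPathsInChains.

Variables (h s L : nat) (e : rel nat).
Hypothesis e_bound : forall m p, induced_path e h m p -> m <= L.

Variables (m : nat) (p : nat -> nat).
Hypothesis p_path : induced_path (cone_chain h e) (s * h.+1) m p.

Let p_inj i j : i < m -> j < m -> p i = p j -> i = j.
Proof. by case: p_path => _ H _; apply: H. Qed.

Let p_adj i j : i < m -> j < m ->
  cone_chain h e (p i) (p j) = (i.+1 == j) || (j.+1 == i).
Proof. by case: p_path => _ _; apply. Qed.

(** A step of the path across [t] would have the vertex [t] as an end, by [cone_chain_jump]. *)
Lemma induced_path_same_side t i j : h.+1 %| t -> i <= j < m ->
  (forall l, i <= l <= j -> p l != t) -> (p i < t) = (p j < t).
Proof.
move=> dt; elim: j => [|j IH] /andP[le_ij lt_jm] no.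
  by have -> : i = 0 by lia.
have [->//|ne] := eqVneq i j.+1.
rewrite IH; [|lia|by move=> l le_l; apply: no; lia].
have nj : p j != t by apply: no; lia.
have nj1 : p j.+1 != t by apply: no; lia.
have Ej : cone_chain h e (p j) (p j.+1) by rewrite p_adj ?eqxx //; lia.
have Ej1 : cone_chain h e (p j.+1) (p j) by rewrite p_adj ?eqxx ?orbT //; lia.
have := cone_chain_jump dt _ Ej; have := cone_chain_jump dt _ Ej1.
case: (ltnP (p j) t) => a; case: (ltnP (p j.+1) t) => b //= H1 H2.
- by have [] := H2 isT; lia.
by have [] := H1 isT; lia.
Qed.

(* The vertices of the path in segments whose first vertex is off the path. *)
Let uncovered : pred nat := fun j =>
  p j %/ h.+1 * h.+1 \notin [seq p l | l <- iota 0 m].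

Let uncoveredP j l : uncovered j -> l < m -> p l != p j %/ h.+1 * h.+1.
Proof.
move=> Uj lt_l; apply: contraNneq Uj => <-.
by apply: map_f; rewrite mem_iota.
Qed.

(** Otherwise the path would cross the apex of the later segment, which it avoids. *)
Lemma uncovered_same_segment i j : i < m -> j < m -> uncovered i -> uncovered j ->
  p i %/ h.+1 = p j %/ h.+1.
Proof.
move=> im jm.
wlog lt : i j im jm / p i %/ h.+1 < p j %/ h.+1.
  move=> W Ui Uj; case: (ltngtP (p i %/ h.+1) (p j %/ h.+1)) => // lt.
  - exact: W.
  by apply/esym; apply: W.
move=> Ui Uj; set t := p j %/ h.+1 * h.+1.
have dt : h.+1 %| t by apply: dvdn_mull.
have it : p i < t by rewrite -ltn_divLR.
have tj : t <= p j by apply: leq_divM.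
have no l : l < m -> p l != t by apply: uncoveredP.
case: (leqP i j) => ij.
  have := @induced_path_same_side t i j dt; rewrite ij jm => /(_ isT).
  by rewrite it ltnNge tj; move=> H; have: true = ~~ true by apply: H => l ?; apply: no; lia.
have := @induced_path_same_side t j i dt; rewrite (ltnW ij) im => /(_ isT).
by rewrite it ltnNge tj; move=> H; have: ~~ true = true by apply: H => l ?; apply: no; lia.
Qed.

(** A subpath with an uncovered vertex meets neither the apex of that segment nor, by hypothesis,
    the next one. So it never leaves the segment and is an induced path in a copy of [e]. *)
Lemma count_uncovered_interval j0 x l : j0 < m -> uncovered j0 -> x + l <= m ->
  (forall i, x <= i < x + l -> p i != (p j0 %/ h.+1).+1 * h.+1) ->
  count uncovered (iota x l) <= L.
Proof.
move=> j0m U0 xl no; have [/hasP[j]|] := boolP (has uncovered (iota x l)); last first.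
  by rewrite has_count -leqNgt leqn0 => /eqP ->.
rewrite mem_iota => /andP[xj jxl] Uj.
apply: leq_trans (count_size _ _) _; rewrite size_iota.
set a := p j0 %/ h.+1 in no.
have Ea : p j %/ h.+1 = a by apply: uncovered_same_segment => //; lia.
have no0 i : i < m -> p i != a * h.+1 by move=> im; apply: uncoveredP.
have blk i : x <= i < x + l -> p i %/ h.+1 = a.
  move=> xil.
  have side t : h.+1 %| t -> (forall i, x <= i < x + l -> p i != t) -> (p i < t) = (p j < t).
    move=> dt not_; case: (leqP i j) => ij.
      by apply: induced_path_same_side => // [|l' ?]; [lia | apply: not_; lia].
    by apply/esym; apply: induced_path_same_side => // [|l' ?]; [lia | apply: not_; lia].
  have lo := side (a * h.+1) (dvdn_mull _ (dvdnn _)).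
  have hi := side (a.+1 * h.+1) (dvdn_mull _ (dvdnn _)) no.
  rewrite -!ltn_divLR // Ea ltnSn ltnn in lo hi.
  by have := lo (fun i Hi => no0 i ltac:(lia)); lia.
have nz i : x <= i < x + l -> p i %% h.+1 != 0.
  move=> xil; have := divn_eq (p i) h.+1; rewrite blk //.
  by have := no0 i; lia.
apply: (e_bound (p := fun i => (p (x + i) %% h.+1).-1)); split.
- move=> i il; have := nz (x + i); have := ltn_pmod (p (x + i)) (ltn0Sn h); lia.
- move=> i i' il il' E.
  have := nz (x + i); have := nz (x + i').
  have := divn_eq (p (x + i)) h.+1; have := divn_eq (p (x + i')) h.+1.
  rewrite !blk; try lia; move=> E1 E2 n1 n2.
  have := @p_inj (x + i) (x + i'); lia.
move=> i i' il il'.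
have xi : x <= x + i < x + l by lia.
have xi' : x <= x + i' < x + l by lia.
have := @p_adj (x + i) (x + i').
rewrite /cone_chain !blk // eqxx !(negPf (nz _ _)) //= => ->; lia.
Qed.

(** The path visits the next apex [t] at most once, by injectivity. Splitting there leaves two
    intervals that avoid [t]. *)
Lemma count_uncovered : count uncovered (iota 0 m) <= L + L.
Proof.
have [/hasP[j0]|] := boolP (has uncovered (iota 0 m)); last first.
  by rewrite has_count -leqNgt leqn0 => /eqP ->.
rewrite mem_iota add0n => /= j0m U0.
pose t := (p j0 %/ h.+1).+1 * h.+1.
have [/mapP[j1]|no] := boolP (t \in [seq p l | l <- iota 0 m]); last first.
  apply: leq_trans (leq_addr _ _); apply: (count_uncovered_interval j0m) => // i im.
  by apply: contraNneq no; rewrite -/t => <-; apply: map_f; rewrite mem_iota.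
rewrite mem_iota add0n => /= j1m Et.
have nU1 : ~~ uncovered j1.
  apply/negP => /(uncovered_same_segment j1m j0m)/(_ U0).
  by rewrite -Et mulnK //; lia.
have -> : m = j1 + (1 + (m - j1.+1)) by lia.
rewrite !iotaD !count_cat /= (negPf nU1) add0n.
apply: leq_add; apply: (count_uncovered_interval j0m) => //; try lia.
  by move=> i ij; apply: contraTneq ij => Ei; have := @p_inj i j1; lia.
by move=> i ij; apply: contraTneq ij => Ei; have := @p_inj i j1; lia.
Qed.

(** An apex on the path is adjacent to its whole segment, so other path vertices there must be its
    neighbours along the path. *)
Lemma count_covered : count (predC uncovered) (iota 0 m) <= 3 * s.
Proof.
pose apex := [seq j <- iota 0 m | p j %% h.+1 == 0].
have apexP j : j \in apex -> p j %% h.+1 = 0 /\ j < m.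
  by rewrite mem_filter mem_iota add0n => /andP[/eqP].
have sz : size apex <= s.
  rewrite -(size_map (fun j => p j %/ h.+1)) -(size_iota 0 s).
  apply: uniq_leq_size.
    rewrite map_inj_in_uniq ?filter_uniq ?iota_uniq // => i j /apexP[i0 im] /apexP[j0 jm] E.
    by apply: p_inj => //; rewrite (divn_eq (p i) h.+1) (divn_eq (p j) h.+1) i0 j0 E.
  move=> _ /mapP[j /apexP[_ jm] ->]; rewrite mem_iota /= add0n ltn_divLR //.
  by case: p_path => H _ _; apply: H.
apply: (@leq_trans (3 * size apex)); last by rewrite leq_mul2l.
(* For [l = 0] the entry [l.-1] merely repeats [l]; only an upper bound is needed. *)
have -> : 3 * size apex = size (flatten [seq [:: l.-1; l; l.+1] | l <- apex]).
  by elim: {apexP sz}apex => //= l r IH; rewrite mulnS IH.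
rewrite -size_filter; apply: uniq_leq_size; first by rewrite filter_uniq ?iota_uniq.
move=> j; rewrite mem_filter mem_iota add0n => /andP[/= Uj jm].
move: Uj; rewrite negbK => /mapP[l]; rewrite mem_iota add0n => /= lm El.
have l0 : p l %% h.+1 = 0 by rewrite -El modnMl.
have lq : p l %/ h.+1 = p j %/ h.+1 by rewrite -El mulnK.
apply/flatten_mapP; exists l.
  by rewrite mem_filter l0 eqxx mem_iota.
have := p_adj lm jm; rewrite /cone_chain lq eqxx l0 eqxx !inE.
case: eqP => [j0 _|_ /= /esym]; last by lia.
by rewrite (@p_inj l j) ?eqxx ?orbT // (divn_eq (p l) h.+1) (divn_eq (p j) h.+1) lq l0 j0.
Qed.

Lemma cone_chain_induced_path : m <= 2 * L + 3 * s.
Proof.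
rewrite -[leqLHS](size_iota 0) -(count_predC uncovered) mul2n -addnn.
exact: leq_add count_uncovered count_covered.
Qed.

End InducedPathsInChains.

(** * The iterated construction *)

Fixpoint chain_order (s d : nat) : nat := if d is d'.+1 then s * (chain_order s d').+1 else 1.

Fixpoint iterated_chain (s d : nat) : rel nat :=
  if d is d'.+1 then cone_chain (chain_order s d') (iterated_chain s d')
  else fun _ _ => false.

Lemma iterated_chain_sym s d : symmetric (iterated_chain s d).
Proof. by elim: d => //= d IH; apply: cone_chain_sym. Qed.

Lemma iterated_chain_irr s d : irreflexive (iterated_chain s d).
Proof. by elim: d => //= d IH; apply: cone_chain_irr. Qed.

Lemma iterated_chain_succ s d i :
  i.+1 < chain_order s d -> iterated_chain s d i i.+1.
Proof. by elim: d i => // d IH i _; apply: cone_chain_succ. Qed.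

Lemma expn_leq_chain_order s d : s ^ d <= chain_order s d.
Proof. by elim: d => //= d IH; rewrite expnS leq_mul2l leqW ?orbT. Qed.

Lemma td2_iterated_chain s d (T : finType) (r : rel T) (A : {set T}) (f : T -> nat) :
  symmetric r -> {in A &, injective f} -> {in A, forall x, f x < chain_order s d} ->
  {in A &, forall x y, r x y = iterated_chain s d (f x) (f y)} ->
  td2_set r A <= d.+1.
Proof.
move=> r_sym; elim: d A f => [|d IH] A f f_inj f_lt rE.
  apply: leq_trans (td2_set_leq r A) _; apply/card_le1_eqP => x y xA yA.
  by apply: f_inj => //; have := f_lt x xA; have := f_lt y yA; rewrite /=; lia.
by apply: td2_cone_chain r_sym _ f_inj rE => // B g; apply: IH.
Qed.

(** The recursion closes because [3 * s] is at most [3 * 5 ^ d * s]; at [d = 0] the single vertex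
    needs [0 < s]. *)
Lemma iterated_chain_induced_path s d m p : 0 < s ->
  induced_path (iterated_chain s d) (chain_order s d) m p -> m <= 5 ^ d * s.
Proof.
move=> s_gt0; elim: d m p => [|d IH] m p.
  case=> lt1 inj _; rewrite mul1n; apply: leq_trans s_gt0.
  rewrite leqNgt; apply/negP => m2.
  have := inj 0 1; have := lt1 0; have := lt1 1; rewrite /=; lia.
move=> path_p; apply: leq_trans (cone_chain_induced_path IH path_p) _.
have : 0 < 5 ^ d by rewrite expn_gt0.
by rewrite expnS; nia.
Qed.

Definition chain_graph s d : sgraph :=
  @SGraph 'I_(chain_order s d) (relpre val (iterated_chain s d))
    (fun i j => iterated_chain_sym s d i j) (fun i => iterated_chain_irr s d i).

Lemma td2_chain_graph s d : td2 (chain_graph s d) <= d.+1.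
Proof.
apply: (@td2_iterated_chain s d _ _ _ val) => //.
- by move=> i j; apply: iterated_chain_sym.
- by move=> i j _ _; apply: val_inj.
- by move=> i _; apply: ltn_ord.
Qed.

Lemma chain_graph_path s d n : n <= s ^ d -> has_subgraph (path_graph n) (chain_graph s d).
Proof.
move=> le_n; have le_o := leq_trans le_n (expn_leq_chain_order s d).
exists (widen_ord le_o) => [i j /(congr1 val) /=|i j]; first by move/val_inj.
rewrite /= /path_adj => /orP[] /eqP E /=.
  by rewrite -E iterated_chain_succ // E; apply: leq_trans le_o.
by rewrite iterated_chain_sym -E iterated_chain_succ // E; apply: leq_trans le_o.
Qed.

Lemma chain_graph_induced_path s d m : 0 < s ->
  has_induced_subgraph (path_graph m) (chain_graph s d) -> m <= 5 ^ d * s.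
Proof.
(* The empty path is set aside because [inord] needs a nonempty ordinal type. *)
move=> s_gt0 [f f_inj fE]; case: m f f_inj fE => // m f f_inj fE.
apply: (@iterated_chain_induced_path s d _ (fun i => f (inord i)) s_gt0); split.
- by move=> i _; apply: ltn_ord.
- by move=> i j im jm /val_inj/f_inj/(congr1 val); rewrite /= !inordK.
- by move=> i j im jm; have := fE (inord i) (inord j); rewrite /= /path_adj !inordK.
Qed.

(** * Choice of [s] and the final bound *)

Local Open Scope ring_scope.

(** For the least [s] with [n <= s ^ d], both [s.-1] and [1] are at most the [d]-th root of [n],
    whence the factor 2. *)
Lemma root_ceiling (R : realType) (d n : nat) : (0 < d)%N -> (0 < n)%N ->
  exists s : nat, [/\ (0 < s)%N, (n <= s ^ d)%N & s%:R <= 2 * n%:R `^ (d%:R^-1) :> R].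
Proof.
move=> d_gt0 n_gt0.
have ex : exists s, (n <= s ^ d)%N.
  by exists n; rewrite -[X in (X <= _)%N]expn1 leq_pexp2l.
case: (ex_minnP ex) => s le_n min_s.
have s_gt0 : (0 < s)%N by case: s le_n {min_s} => //; rewrite exp0n //; lia.
exists s; split=> //.
have lt_n : (s.-1 ^ d < n)%N.
  by rewrite ltnNge; apply/negP => /min_s; lia.
have d0 : d%:R != 0 :> R by rewrite pnatr_eq0; lia.
have le1 : s.-1%:R <= n%:R `^ (d%:R^-1) :> R.
  have -> : s.-1%:R = (s.-1 ^ d)%:R `^ (d%:R^-1) :> R.
    by rewrite natrX -powR_mulrn // -powRrM divff // powRr1.
  by apply: ge0_ler_powR; rewrite ?invr_ge0 ?nnegrE ?ler0n // ler_nat ltnW.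
have le2 : 1 <= n%:R `^ (d%:R^-1) :> R.
  have : 1 `^ (d%:R^-1) <= n%:R `^ (d%:R^-1) :> R; last by rewrite powR1.
  by apply: ge0_ler_powR; rewrite ?invr_ge0 ?nnegrE ?ler0n ?ler01 // ler1n.
by rewrite -(prednK s_gt0) -addn1 natrD mulr_natl mulr2n lerD.
Qed.

Theorem theorem6 (R : realType) (k : nat) (hk : (2 <= k)%N) :
  exists2 c : R, 0 < c &
    forall n : nat, (0 < n)%N ->
      exists G : sgraph,
        [/\ (td2 G <= k)%N,
            has_subgraph (path_graph n) G &
            forall m : nat, has_induced_subgraph (path_graph m) G ->
              m%:R <= c * (n%:R `^ (1 / (k%:R - 1)))].
Proof.
case: k hk => // d; rewrite ltnS => d_gt0.
(* The factor [5 ^ d] bounds induced paths; the factor 2 pays for rounding the root up. *)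
exists ((5 ^ d)%:R * 2) => [|n n_gt0]; first by rewrite mulr_gt0 // ltr0n expn_gt0.
have [s [s_gt0 le_n le_s]] := root_ceiling R d_gt0 n_gt0.
exists (chain_graph s d); split; [exact: td2_chain_graph|exact: chain_graph_path|].
move=> m /(chain_graph_induced_path s_gt0) le_m.
have -> : 1 / (d.+1%:R - 1) = d%:R^-1 :> R by rewrite div1r -natr1 addrK.
rewrite -mulrA; apply: le_trans (_ : (5 ^ d * s)%:R <= _); first by rewrite ler_nat.
by rewrite natrM ler_wpM2l.
Qed.
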